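(* Let $\Gamma$ be a finite simplicial graph whose edges are labeled by integers $\geq 2$, and let $A_\Gamma$ be the associated Artin group. Assume that $\Gamma$ is not the star of a single vertex. Then the center of $A_\Gamma$ is trivial.
   Context: Let $\Gamma$ be a finite simplicial graph (no loops, no multiple edges) with vertex set $S=\{s_1,\dots,s_n\}$, in which each edge joining $s_i$ and $s_j$ is labeled by an integer $m_{i,j}=m_{j,i}\geq 2$. The Artin group $A_\Gamma$ is the group with generating set $S$ and, for each pair $s_i,s_j$ joined by an edge, the relation $s_is_js_i\cdots = s_js_is_j\cdots$, where both sides are alternating words with exactly $m_{i,j}$ letters (no relation is imposed on pairs not joined by an edge). $\Gamma$ is the star of a single vertex if there is a vertex $s$ of $\Gamma$ such that every other vertex of $\Gamma$ is joined to $s$ by an edge. Thus $\Gamma$ is not the star of a single vertex if and only if for every vertex $s$ there is a vertex $t_s\neq s$ not joined to $s$ by an edge. Edge labels play no role in this condition. *)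

(* Defs.v *)
From HB Require Import structures.
From mathcomp Require Import all_boot.
From mathcomp Require Import boolp classical_sets.

Set Implicit Arguments.
Unset Strict Implicit.
Unset Printing Implicit Defensive.

Local Open Scope group_scope.
Local Open Scope quotient_scope.

Section Presentation.
Variable X : choiceType.

(* (x, true) is the generator x and (x, false) its formal inverse. *)
Definition word := seq (X * bool).

Definition winv (u : word) : word := rev [seq (l.1, ~~ l.2) | l <- u].

Variable R : word -> word -> Prop.

(* The smallest congruence on words containing R and free cancellation. *)
Inductive pres_eq : word -> word -> Prop :=
| pres_refl u : pres_eq u u
| pres_sym u v : pres_eq u v -> pres_eq v u
| pres_trans u v w : pres_eq u v -> pres_eq v w -> pres_eq u w
| pres_cat u u' v v' :
    pres_eq u u' -> pres_eq v v' -> pres_eq (u ++ v) (u' ++ v')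
| pres_cancel x b : pres_eq [:: (x, b); (x, ~~ b)] [::]
| pres_rel u v : R u v -> pres_eq u v.

Definition pres_eqb : rel word := fun u v => `[< pres_eq u v >].

Lemma pres_eqb_refl : reflexive pres_eqb.
Proof. by move=> u; apply/asboolP/pres_refl. Qed.

Lemma pres_eqb_sym : symmetric pres_eqb.
Proof. by move=> u v; apply/asboolP/asboolP => /pres_sym. Qed.

Lemma pres_eqb_trans : transitive pres_eqb.
Proof.
by move=> v u w /asboolP uv /asboolP vw; apply/asboolP/(pres_trans uv vw).
Qed.

Canonical pres_equiv :=
  EquivRel pres_eqb pres_eqb_refl pres_eqb_sym pres_eqb_trans.

(* The group < X | u = v for all (u, v) in R >. *)
Definition presented := {eq_quot pres_equiv}.

HB.instance Definition _ := Choice.on presented.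

Definition pclass (u : word) : presented := \pi_({eq_quot pres_equiv}) u.

Lemma pclassP u v : pclass u = pclass v <-> pres_eq u v.
Proof. by split=> [/eqquotP/asboolP|uv]; last exact/eqquotP/asboolP. Qed.

Lemma pclass_repr (a : presented) : pclass (repr a) = a.
Proof. exact: reprK. Qed.

Lemma repr_pclass u : pres_eq (repr (pclass u)) u.
Proof. exact/pclassP/pclass_repr. Qed.

Lemma winvK : involutive winv.
Proof.
move=> u; rewrite /winv map_rev revK -map_comp -[RHS]map_id.
by apply: eq_map => -[x b] /=; rewrite negbK.
Qed.

Lemma winv_cons l u : winv (l :: u) = winv u ++ [:: (l.1, ~~ l.2)].
Proof. by rewrite /winv /= rev_cons cats1. Qed.

Lemma pres_mulwV u : pres_eq (u ++ winv u) [::].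
Proof.
elim: u => [|[x b] u IHu]; first exact: pres_refl.
apply: pres_trans (pres_cancel x b).
have -> : ((x, b) :: u) ++ winv ((x, b) :: u) =
    [:: (x, b)] ++ (u ++ winv u) ++ [:: (x, ~~ b)].
  by rewrite winv_cons -catA.
exact: (pres_cat (pres_refl [:: (x, b)]) (pres_cat IHu (pres_refl _))).
Qed.

Lemma pres_mulVw u : pres_eq (winv u ++ u) [::].
Proof. by rewrite -{2}[u]winvK; apply: pres_mulwV. Qed.

Definition pres_one : presented := pclass [::].
Definition pres_mul (a b : presented) : presented :=
  pclass (repr a ++ repr b).
Definition pres_inv (a : presented) : presented := pclass (winv (repr a)).

Lemma pclass_cat u v : pclass (u ++ v) = pres_mul (pclass u) (pclass v).
Proof. by apply/pclassP; apply: pres_cat; apply/pres_sym/repr_pclass. Qed.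

Fact pres_mulA : associative pres_mul.
Proof.
move=> a b c; rewrite -(pclass_repr a) -(pclass_repr b) -(pclass_repr c).
by rewrite -!pclass_cat catA.
Qed.

Fact pres_mul1 : left_id pres_one pres_mul.
Proof. by move=> a; rewrite -(pclass_repr a) -pclass_cat. Qed.

Fact pres_mulr1 : right_id pres_one pres_mul.
Proof. by move=> a; rewrite -(pclass_repr a) -pclass_cat cats0. Qed.

Fact pres_mulVg : left_inverse pres_one pres_inv pres_mul.
Proof.
by move=> a; rewrite -{2}(pclass_repr a) -pclass_cat; apply/pclassP/pres_mulVw.
Qed.

Fact pres_mulgV : right_inverse pres_one pres_inv pres_mul.
Proof.
by move=> a; rewrite -{1}(pclass_repr a) -pclass_cat; apply/pclassP/pres_mulwV.
Qed.

HB.instance Definition _ := isGroup.Build presented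
  pres_mulA pres_mul1 pres_mulr1 pres_mulVg pres_mulgV.

End Presentation.

Section Artin.
Variables (S : finType) (e : rel S) (m : S -> S -> nat).

Fixpoint alt_word (k : nat) (s t : S) : word S :=
  if k is k'.+1 then (s, true) :: alt_word k' t s else [::].

Inductive artin_rel : word S -> word S -> Prop :=
| ArtinRel s t : e s t ->
    artin_rel (alt_word (m s t) s t) (alt_word (m s t) t s).

Definition artin_group : groupType := presented artin_rel.

Definition is_star : Prop := exists s, forall t, t != s -> e s t.

End Artin.

Definition group_center (G : groupType) : set G :=
  [set z | forall g : G, commute z g]%classic.

Arguments group_center G _ : clear implicits.

(* Main.v *)
(** Let [z] be central. If [s] and [t] are not adjacent, the presentation shows
    that [A_Gamma] is the amalgam of its subgroups [A = <S \ s>] and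
    [B = <S \ t>] over [C = <S \ {s, t}>], so [z] lies in [A]: a reduced product
    [a_0 b_1 a_1 ... b_k a_k] with [k > 0] acts on polynomial-valued functions,
    [B] being conjugated by the transvection [1 + 'X n] where [n] is a rank one
    operator commuting with [C] and [n g n <> 0] exactly for [g] outside [C]; the
    coefficient of degree [2k] then depends on the coset [a_0 C] and prevents the
    product from commuting with [A].
    As no vertex is adjacent to all the others, [z] lies in every [<S \ s>], and
    it remains to see that [<X>] and [<Y>] intersect in [<X :&: Y>]. Following
    Charney and Paris, [A_Gamma] acts on [W / W_X] times [A_Gamma] (as a set),
    where [W] is a Coxeter group: a generator [s] moves the coset of the minimal
    representative [w], unless [s w = w x] with [x] in [X], in which case it fixes
    the coset and multiplies the second component by [x]. The orbit map is the
    identity on [<X>] and sends [<Y>] into [<X :&: Y>]. *)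

Require Import Defs.
From HB Require Import structures.
From mathcomp Require Import all_boot all_order all_algebra.
From mathcomp Require Import ring lra zify.
From mathcomp Require Import boolp classical_sets reals Rstruct trigo.

Set Implicit Arguments.
Unset Strict Implicit.
Unset Printing Implicit Defensive.
Import Order.TTheory GRing.Theory Num.Theory.

Local Open Scope ring_scope.

(** * Actions of presented groups *)

Section PresentedAction.
Variables (X : choiceType) (R : word X -> word X -> Prop) (T : Type).
Variables (P : T -> Prop) (act : X * bool -> T -> T).

Definition wordact (u : word X) (p : T) : T := foldr act p u.

Lemma wordact_cons l u p : wordact (l :: u) p = act l (wordact u p).
Proof. by []. Qed.

Lemma wordact_cat u1 u2 p : wordact (u1 ++ u2) p = wordact u1 (wordact u2 p).
Proof. exact: foldr_cat. Qed.

Hypothesis actP : forall l p, P p -> P (act l p).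

Lemma wordactP u p : P p -> P (wordact u p).
Proof. by move=> Pp; elim: u => //= l u IHu; apply: actP. Qed.

Hypothesis actK : forall x b p, P p -> act (x, b) (act (x, ~~ b) p) = p.
Hypothesis actR : forall u v p, R u v -> P p -> wordact u p = wordact v p.

(** Makes an action of letters descend to the presented group. The relations need only hold on the
    stable set [P]: below, right-invariant functions, then pairs over a minimal coset
    representative. *)
Lemma wordact_pres_eq u v p : pres_eq R u v -> P p -> wordact u p = wordact v p.
Proof.
move=> uv; elim: uv p => {u v} [//|u v _ IH p Pp|u v w _ IH1 _ IH2 p Pp|
  u u' v v' _ IH1 _ IH2 p Pp|x b p Pp|u v ruv p Pp]; first by rewrite IH.
- by rewrite IH1 // IH2.
- by rewrite !wordact_cat IH2 // IH1 //; apply: wordactP.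
- exact: actK.
- exact: actR.
Qed.
End PresentedAction.

(** * Subgroups generated by sets of vertices *)

Section Generated.
Variables (S : finType) (e : rel S) (m : S -> S -> nat).
Local Notation G := (artin_group e m).

Definition cls (u : word S) : G := pclass (artin_rel e m) u.

Lemma cls_cat u v : cls (u ++ v) = (cls u * cls v)%g.
Proof. exact: pclass_cat. Qed.

Lemma cls_nil : cls [::] = 1%g.
Proof. by []. Qed.

Lemma cls_winv u : cls (winv u) = ((cls u)^-1)%g.
Proof.
apply: (@mulgI _ (cls u)); rewrite mulgV -cls_cat -cls_nil.
exact/pclassP/pres_mulwV.
Qed.

Lemma cls_repr (g : G) : cls (repr (g : presented _)) = g.
Proof. exact: pclass_repr. Qed.

Definition gen (Y : pred S) (g : G) : Prop :=
  exists2 u, all (fun l => Y l.1) u & g = cls u.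

Lemma gen_mul Y g h : gen Y g -> gen Y h -> gen Y (g * h)%g.
Proof.
by move=> [u Yu ->] [v Yv ->]; exists (u ++ v); rewrite ?all_cat ?Yu // cls_cat.
Qed.

Lemma gen_one Y : gen Y 1%g.
Proof. by exists [::]. Qed.

Lemma gen_inv Y g : gen Y g -> gen Y (g^-1)%g.
Proof.
move=> [u Yu ->]; exists (winv u); last by rewrite cls_winv.
by rewrite /winv all_rev all_map.
Qed.

Lemma gen_invE Y g : gen Y (g^-1)%g <-> gen Y g.
Proof. by split=> /gen_inv //; rewrite invgK. Qed.

Lemma gen_mulr Y g h : gen Y h -> gen Y (g * h)%g <-> gen Y g.
Proof.
move=> Yh; split=> [Ygh|Yg]; last exact: gen_mul.
by rewrite -(mulgK h g); apply/gen_mul/gen_inv.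
Qed.

Lemma gen_mull Y g h : gen Y g -> gen Y (g * h)%g <-> gen Y h.
Proof.
move=> Yg; split=> [Ygh|Yh]; last exact: gen_mul.
by rewrite -(mulKg g h); apply: gen_mul => //; apply: gen_inv.
Qed.

Lemma gen_sub (Y Z : pred S) g : subpred Y Z -> gen Y g -> gen Z g.
Proof. by move=> YZ [u Yu ->]; exists u => //; apply: sub_all Yu => l; apply: YZ. Qed.

Lemma gen_letter (Y : pred S) l : Y l.1 -> gen Y (cls [:: l]).
Proof. by move=> Yl; exists [:: l] => //=; rewrite Yl. Qed.

Lemma all_alt_word (Y : pred S) k s t : Y s -> Y t ->
  all (fun l => Y l.1) (alt_word k s t).
Proof. by elim: k s t => //= k IHk s t Ys Yt; rewrite Ys IHk. Qed.

Lemma cls_cancel x b : cls [:: (x, b); (x, ~~ b)] = 1%g.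
Proof. exact/pclassP/pres_cancel. Qed.

Lemma cls_rel s t : e s t -> cls (alt_word (m s t) s t) = cls (alt_word (m s t) t s).
Proof. by move=> st; apply/pclassP/pres_rel. Qed.

(** * Centers of amalgams *)

Section Amalgam.
Hypotheses (e_sym : symmetric e).
Variables (s t : S).
Hypotheses (st : s != t) (est : ~~ e s t).

Let A := gen (fun r => r != s).
Let B := gen (fun r => r != t).
Let C := gen (fun r => (r != s) && (r != t)).

Definition right_inv (phi : G -> {poly int}) : Prop :=
  forall h c, C c -> phi (h * c)%g = phi h.

Definition outside (h : G) : int := if `[< C h >] then 0 else 1.

Lemma outside1 : outside 1%g = 0.
Proof. by rewrite /outside asboolT //; apply: gen_one. Qed.

Lemma outsideN h : ~ C h -> outside h = 1.
Proof. by move=> Ch; rewrite /outside asboolF. Qed.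

Lemma outsideMr h c : C c -> outside (h * c)%g = outside h.
Proof.
move=> Cc; rewrite /outside.
by rewrite (propext (gen_mulr h Cc : C (h * c)%g <-> C h)).
Qed.

Lemma outsideMl h c : C c -> outside (c * h)%g = outside h.
Proof.
move=> Cc; rewrite /outside.
by rewrite (propext (gen_mull h Cc : C (c * h)%g <-> C h)).
Qed.

(** The transvection [1 + a n], where [n phi] is [phi 1] times the indicator of the complement of
    [C]. As [outside] vanishes at 1, [n] squares to zero and [twist (- a)] is the inverse. *)
Definition twist (a : {poly int}) (phi : G -> {poly int}) : G -> {poly int} :=
  fun h => phi h + a * phi 1%g * (outside h)%:P.

Lemma twistK a phi : twist a (twist (- a) phi) = phi.
Proof.
apply/funext => h; rewrite /twist outside1.
by rewrite !mulr0 addr0 !mulNr addrNK.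
Qed.

Lemma twistNK a phi : twist (- a) (twist a phi) = phi.
Proof. by rewrite -{2}(opprK a) twistK. Qed.

Definition ltrans (g : G) (phi : G -> {poly int}) : G -> {poly int} :=
  fun h => phi (g^-1 * h)%g.

Lemma ltransM g h phi : ltrans (g * h)%g phi = ltrans g (ltrans h phi).
Proof. by apply/funext => x; rewrite /ltrans invgM mulgA. Qed.

Lemma ltrans1 phi : ltrans 1%g phi = phi.
Proof. by apply/funext => x; rewrite /ltrans invg1 mul1g. Qed.

Lemma right_inv_twist a phi : right_inv phi -> right_inv (twist a phi).
Proof. by move=> P h c Cc; rewrite /twist outsideMr // P. Qed.

Lemma right_inv_ltrans g phi : right_inv phi -> right_inv (ltrans g phi).
Proof. by move=> P h c Cc; rewrite /ltrans mulgA P. Qed.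

(** On right-invariant functions, evaluation at 1 and [outside] are both unchanged by translations
    by [C]. *)
Lemma twist_ltrans a g phi : C g -> right_inv phi ->
  twist a (ltrans g phi) = ltrans g (twist a phi).
Proof.
move=> Cg P; apply/funext => h; rewrite /twist /ltrans outsideMl; last exact: gen_inv.
by rewrite mulg1; have := P 1%g _ (gen_inv Cg); rewrite mul1g => ->.
Qed.

(* [<S \ t>] acts by translations conjugated by [twist 'X], and [<S \ s>] by
   plain translations; both agree on [C] since [twist] commutes with [C]. *)
Definition tact (l : S * bool) (phi : G -> {poly int}) : G -> {poly int} :=
  if l.1 == s then twist 'X (ltrans (cls [:: l]) (twist (- 'X) phi))
  else ltrans (cls [:: l]) phi.

Lemma right_inv_tact l phi : right_inv phi -> right_inv (tact l phi).
Proof.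
move=> P; rewrite /tact; case: ifP => _; last exact: right_inv_ltrans.
exact/right_inv_twist/right_inv_ltrans/right_inv_twist.
Qed.

Lemma tactA u phi : all (fun l => l.1 != s) u -> wordact tact u phi = ltrans (cls u) phi.
Proof.
elim: u => /= [_|l u IHu /andP[ls us]]; first by rewrite ltrans1.
by rewrite IHu // /tact (negbTE ls) -ltransM -cls_cat.
Qed.

Lemma tactB u phi : right_inv phi -> all (fun l => l.1 != t) u ->
  wordact tact u phi = twist 'X (ltrans (cls u) (twist (- 'X) phi)).
Proof.
move=> P; elim: u => /= [_|l u IHu /andP[ls us]]; first by rewrite ltrans1 twistK.
rewrite IHu // /tact; case: eqP => [_|/eqP lt].
  by rewrite twistNK -ltransM -cls_cat.
rewrite -twist_ltrans -?ltransM -?cls_cat //.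
  by apply: gen_letter; rewrite lt.
exact/right_inv_ltrans/right_inv_twist.
Qed.

Lemma tactK x b phi : right_inv phi -> tact (x, b) (tact (x, ~~ b) phi) = phi.
Proof.
move=> P; rewrite -[LHS]/(wordact tact [:: (x, b); (x, ~~ b)] phi).
case: (eqVneq x t) => [xt|xt].
  by rewrite tactA /= ?xt 1?eq_sym ?st // -?xt cls_cancel ltrans1.
by rewrite tactB //= ?xt // cls_cancel ltrans1 twistK.
Qed.

(** A relation involves two adjacent vertices, hence never both [s] and [t]: all its letters lie in
    [A] or all lie in [B]. *)
Lemma tactR u v phi : artin_rel e m u v -> right_inv phi ->
  wordact tact u phi = wordact tact v phi.
Proof.
case=> a b ab P.
have [/andP[at_ bt]|] := boolP ((a != t) && (b != t)).
  by rewrite !tactB ?cls_rel //; apply: (@all_alt_word (fun r => r != t)).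
rewrite negb_and !negbK => abt.
suff /andP[as_ bs] : (a != s) && (b != s).
  by rewrite !tactA ?cls_rel //; apply: (@all_alt_word (fun r => r != s)).
case/orP: abt => /eqP h; move: ab; rewrite h [t == s]eq_sym st ?andbT /=;
  apply: contraTneq => ->; by rewrite // e_sym.
Qed.

Lemma tact_cls u v phi : cls u = cls v -> right_inv phi ->
  wordact tact u phi = wordact tact v phi.
Proof.
move=> /pclassP uv; apply: wordact_pres_eq uv.
- exact: right_inv_tact.
- exact: tactK.
- exact: tactR.
Qed.

Definition rho (g : G) (phi : G -> {poly int}) := wordact tact (repr (g : presented _)) phi.

Lemma rho_cls u phi : right_inv phi -> rho (cls u) phi = wordact tact u phi.
Proof. by apply: tact_cls; rewrite cls_repr. Qed.

Lemma right_inv_rho g phi : right_inv phi -> right_inv (rho g phi).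
Proof. by apply: wordactP; apply: right_inv_tact. Qed.

Lemma rhoM g h phi : right_inv phi -> rho (g * h)%g phi = rho g (rho h phi).
Proof.
by move=> P; rewrite -{1}(cls_repr g) -{1}(cls_repr h) -cls_cat rho_cls // wordact_cat.
Qed.

Lemma rhoA g phi : A g -> right_inv phi -> rho g phi = ltrans g phi.
Proof. by move=> [u us ->] P; rewrite rho_cls // tactA. Qed.

Lemma rhoB g phi : B g -> right_inv phi ->
  rho g phi = twist 'X (ltrans g (twist (- 'X) phi)).
Proof. by move=> [u us ->] P; rewrite rho_cls // tactB. Qed.

(** * Reduced products and their leading coefficients *)

Lemma C_sub_A g : C g -> A g.
Proof. by apply: gen_sub => r /andP[]. Qed.

Lemma C_sub_B g : C g -> B g.
Proof. by apply: gen_sub => r /andP[]. Qed.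

(* [nf k a g]: [g] is a reduced product [a b_1 a_1 ... b_k a_k] with [a] in
   [A], the [b_i] in [B \ C] and [a_1], ..., [a_(k-1)] in [A \ C]. *)
Inductive nf : nat -> G -> G -> Prop :=
| nf0 a : A a -> nf 0 a a
| nfS k a b a' g : A a -> B b -> ~ C b -> nf k a' g -> (k == 0%N) \/ ~ C a' ->
    nf k.+1 a (a * b * g)%g.

Lemma nf_mulA k a g a1 : A a1 -> nf k a g -> nf k (a1 * a)%g (a1 * g)%g.
Proof.
move=> Aa1; case=> [a0 Aa0|k' a0 b a' g' Aa Bb Cb n h].
  by apply: nf0; apply: gen_mul.
by rewrite !mulgA; apply: nfS n h => //; apply: gen_mul.
Qed.

(** A factor [b] in [C] is absorbed by [a]. Otherwise it opens a new syllable, except that if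
    [k > 0] and [a] lies in [C], [b] merges with the first syllable into one element of [B],
    absorbed in turn if it falls in [C]. *)
Lemma nf_mulB k a g b : B b -> nf k a g -> exists k' a', nf k' a' (b * g)%g.
Proof.
move=> Bb n.
have [Cb|Cb] := pselect (C b).
  by exists k, (b * a)%g; apply: nf_mulA n; apply: C_sub_A.
have new : (k == 0%N) \/ ~ C a -> exists k' a', nf k' a' (b * g)%g.
  move=> h; exists k.+1, 1%g; rewrite -[b in nf _ _ (b * _)%g]mul1g.
  by apply: nfS n h => //; apply: gen_one.
case: n new => [a0 Aa0|k' a0 b1 a' g' Aa Bb1 Cb1 n h] new; first by apply: new; left.
have [Ca|Ca] := pselect (C a0); last by apply: new; right.
have Bb2 : B (b * a0 * b1)%g by do 2 apply: gen_mul => //; apply: C_sub_B.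
rewrite !mulgA.
have [Cb2|Cb2] := pselect (C (b * a0 * b1)%g).
  by exists k', (b * a0 * b1 * a')%g; apply: nf_mulA n; apply: C_sub_A.
exists k'.+1, 1%g; rewrite -[(b * a0 * b1)%g]mul1g.
by apply: nfS n h => //; apply: gen_one.
Qed.

Lemma nf_exists g : exists k a, nf k a g.
Proof.
rewrite -(cls_repr g); elim: (repr _) => [|l u [k [a n]]].
  by exists 0%N, 1%g; apply: nf0; apply: gen_one.
rewrite -cat1s cls_cat; case: (eqVneq l.1 s) => [ls|ls].
  by apply: nf_mulB n; apply: gen_letter; rewrite ls.
by exists k, (cls [:: l] * a)%g; apply: nf_mulA n; apply: gen_letter.
Qed.

(** Each syllable raises the degree bound by two, once in each conjugating twist. The top
    coefficient survives because the previous one, evaluated at 1, is a sign: [a'] lies outside [C],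
    or no syllable is left. *)
Lemma rho_lead k a g : nf k a g -> forall h,
  (forall j, (k.*2 < j)%N -> (rho g (fun=> 1) h)`_j = 0) /\
  (rho g (fun=> 1) h)`_(k.*2) =
    (-1) ^+ k * (if k == 0%N then 1 else outside (a^-1 * h)%g).
Proof.
have P1 : right_inv (fun=> 1) by [].
elim=> {k a g} [a Aa h|k a b a' g Aa Bb Cb n IH ka h].
  rewrite rhoA // /ltrans; split=> [j j0|]; rewrite coef1 ?mul1r //.
  by case: j j0.
have lead1 : (rho g (fun=> 1) 1%g)`_(k.*2) = (-1) ^+ k.
  have [_ ->] := IH 1%g; case: eqP ka => [_ _|k0 [//|Ca']]; first by rewrite mulr1.
  by rewrite mulg1 outsideN ?mulr1 // => /gen_invE.
have Pg : right_inv (rho g (fun=> 1)) := right_inv_rho g P1.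
rewrite rhoM // rhoM // (rhoA Aa (right_inv_rho b Pg)) rhoB //.
set psi := rho g _ in lead1 IH *.
pose psi1 := twist (- 'X) psi.
have c1 x j : (k.*2.+1 < j)%N -> (psi1 x)`_j = 0.
  move=> kj; rewrite /psi1 /twist coefD mulNr mulNr coefN coefMC coefXM.
  case: j kj => // j kj /=.
  have [hx _] := IH x; have [h1 _] := IH 1%g.
  by rewrite hx ?h1 ?mul0r ?oppr0 ?addr0 //; lia.
have c2 : (psi1 b^-1%g)`_(k.*2.+1) = - (-1) ^+ k.
  rewrite /psi1 /twist coefD mulNr mulNr coefN coefMC coefXM /= lead1.
  have [hb _] := IH b^-1%g; rewrite hb // add0r outsideN ?mulr1 //.
  by move=> /gen_invE.
rewrite /ltrans /twist -/psi1 mulg1.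
rewrite -[psi _ + _]/(psi1 _) -[psi _ + _]/(psi1 _).
rewrite doubleS; split=> [j kj|]; rewrite coefD coefMC coefXM /=.
  case: j kj => // j kj /=.
  by rewrite !c1 ?mul0r ?addr0 //; lia.
by rewrite c1 // c2 add0r exprS mulN1r.
Qed.

Lemma center_amalgam z : ~ C (cls [:: (t, true)]) -> group_center G z -> A z.
Proof.
move=> Ct cz; have [k [a n]] := nf_exists z.
case: k n => [|k] n; first by inversion n.
pose t1 := cls [:: (t, true)].
have At1 : A t1 by apply: gen_letter; rewrite /= eq_sym.
have Aa : A a by inversion n.
have P1 : right_inv (fun=> 1) by [].
(* [z] sends the constant [1] to a function fixed by [A], but the leading
   coefficient of that function is the indicator of the complement of [a C]. *)
pose b := (a * t1 * a^-1)%g.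
have Ab : A b by apply: gen_mul; [apply: gen_mul|apply: gen_inv].
have bz : rho b (rho z (fun=> 1)) = rho z (fun=> 1).
  by rewrite -rhoM // -(cz b) rhoM // (rhoA Ab).
have [_ l1] := rho_lead n a; have [_ l2] := rho_lead n (b^-1 * a)%g.
move: l1; rewrite -bz rhoA //; last exact: right_inv_rho.
rewrite /ltrans l2 /= mulVg outside1 mulr0.
(* Conjugating [t1] by [a] makes [b^-1 * a = a * t1^-1] leave the coset [a C]: the same coefficient
   is 0 at [a] and a sign at [b^-1 * a]. *)
have -> : (a^-1 * (b^-1 * a))%g = (t1^-1)%g.
  by rewrite /b !invgM invgK !mulgA mulVg mul1g mulgVK.
rewrite outsideN ?mulr1; last by move=> /gen_invE.
by move=> /eqP; rewrite signr_eq0.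
Qed.
End Amalgam.
End Generated.

(** * The geometric representation and its roots *)

(** Chebyshev polynomials of the second kind, shifted and rescaled:
    [chebU (2 cos x) k * sin x = sin (k x)]. *)
Fixpoint chebU (R : pzRingType) (c : R) (n : nat) : R :=
  if n is n1.+1 then (if n1 is n2.+1 then c * chebU c n1 - chebU c n2 else 1)
  else 0.

Lemma chebUSS (R : pzRingType) (c : R) n :
  chebU c n.+2 = c * chebU c n.+1 - chebU c n.
Proof. by []. Qed.

(* Algebraic characterisation of [c = 2 cos (pi / m)]. *)
Definition dihedral_coef (R : numDomainType) (m : nat) (c : R) : Prop :=
  [/\ c < 2, forall k, (0 < k < m)%N -> 0 < chebU c k & chebU c m = 0].

Section Chebyshev.
Variables (R : realFieldType) (m : nat) (c : R).
Hypotheses (m_ge2 : (2 <= m)%N) (cP : dihedral_coef m c).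

Lemma dihedral_coef_ge0 : 0 <= c.
Proof.
case: cP => _ pos zero.
have U2 : chebU c 2 = c by rewrite /= mulr1 subr0.
case: (ltngtP m 2) => hm; first by lia.
- by rewrite -U2 ltW // pos.
- by rewrite -U2 -hm zero.
Qed.

(** A conserved quantity of the recurrence; where [chebU c m] vanishes, it forces [chebU c m.-1] to
    be 1 or -1. *)
Lemma chebU_norm k :
  chebU c k.+1 ^+ 2 - c * chebU c k * chebU c k.+1 + chebU c k ^+ 2 = 1.
Proof.
elim: k => [|k IHk]; first by rewrite /=; ring.
by rewrite -[RHS]IHk chebUSS; ring.
Qed.

Lemma chebU_pred : chebU c m.-1 = 1.
Proof.
case: cP => _ pos zero.
have := chebU_norm m.-1; rewrite prednK ?zero; last by lia.
rewrite mulr0 expr0n subr0 add0r => /eqP; rewrite sqrf_eq1 => /orP[/eqP//|/eqP].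
have : 0 < chebU c m.-1 by apply: pos; lia.
by move=> /[swap] ->; rewrite oppr_gt0 ltr10.
Qed.

Lemma dihedral_coef_inj m' : (2 <= m')%N -> dihedral_coef m' c -> m' = m.
Proof.
move=> m'2 [_ pos' zero']; case: cP => _ pos zero.
case: (ltngtP m' m) => // h.
- by have := pos m'; rewrite zero' ltxx h (ltnW m'2) => /(_ isT).
- by have := pos' m; rewrite zero ltxx h (ltnW m_ge2) => /(_ isT).
Qed.
End Chebyshev.

Section Reflections.
Variables (R : realFieldType) (S : finType) (M : S -> S -> nat) (c : S -> S -> R).
Hypotheses (M_sym : forall s t, M s t = M t s)
  (M_ge2 : forall s t, (2 <= M s t)%N)
  (c_sym : forall s t, c s t = c t s)
  (cP : forall s t, dihedral_coef (M s t) (c s t)).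

Let V := {ffun S -> R^o}.

Definition simple (s : S) : V := [ffun i => (i == s)%:R].

(** Twice the Tits form of [v] against [simple s], once [c s t] is [2 cos (pi / M s t)]. *)
Definition coroot (s : S) (v : V) : R :=
  \sum_j v j * (if j == s then 2 else - c j s).

Definition refl (s : S) (v : V) : V := v - coroot s v *: simple s.

Lemma corootD s u v : coroot s (u + v) = coroot s u + coroot s v.
Proof.
by rewrite /coroot -big_split; apply: eq_bigr => j _; rewrite ffunE mulrDl.
Qed.

Lemma corootZ s a v : coroot s (a *: v) = a * coroot s v.
Proof.
rewrite /coroot mulr_sumr; apply: eq_bigr => j _.
by rewrite ffunE mulrA.
Qed.

Lemma coroot_simple s t : coroot s (simple t) = if t == s then 2 else - c t s.
Proof.
rewrite /coroot (bigD1 t) //= ffunE eqxx mul1r big1 ?addr0 // => j /negPf jt.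
by rewrite ffunE jt mul0r.
Qed.

Lemma reflD s u v : refl s (u + v) = refl s u + refl s v.
Proof. by rewrite /refl corootD scalerDl opprD addrACA. Qed.

Lemma reflZ s a v : refl s (a *: v) = a *: refl s v.
Proof. by rewrite /refl corootZ scalerBr scalerA. Qed.

Lemma refl_simple s : refl s (simple s) = - simple s.
Proof.
by rewrite /refl coroot_simple eqxx scaler_nat mulr2n opprD addrA subrr sub0r.
Qed.

Lemma refl_simpleN s t : s != t -> refl s (simple t) = simple t + c t s *: simple s.
Proof.
by move=> /negPf st; rewrite /refl coroot_simple eq_sym st scaleNr opprK.
Qed.

Lemma reflK s : involutive (refl s).
Proof.
move=> v; rewrite {2}/refl reflD -scaleNr reflZ refl_simple /refl scalerN scaleNr.
by rewrite opprK subrK.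
Qed.

Definition wact (u : seq S) (v : V) : V := foldr refl v u.

Lemma wact_cons s u v : wact (s :: u) v = refl s (wact u v).
Proof. by []. Qed.

Lemma wact_cat u1 u2 v : wact (u1 ++ u2) v = wact u1 (wact u2 v).
Proof. exact: foldr_cat. Qed.

Lemma wact_rcons u s v : wact (rcons u s) v = wact u (refl s v).
Proof. by rewrite -cats1 wact_cat. Qed.

Lemma wactD u v1 v2 : wact u (v1 + v2) = wact u v1 + wact u v2.
Proof. by elim: u => //= s u ->; rewrite reflD. Qed.

Lemma wactZ u a v : wact u (a *: v) = a *: wact u v.
Proof. by elim: u => //= s u ->; rewrite reflZ. Qed.

Lemma wactN u v : wact u (- v) = - wact u v.
Proof. by rewrite -scaleN1r wactZ scaleN1r. Qed.

Lemma wact_revK u v : wact (rev u) (wact u v) = v.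
Proof.
elim: u v => //= s u IHu v.
by rewrite rev_cons wact_rcons reflK IHu.
Qed.

Lemma wactK_rev u v : wact u (wact (rev u) v) = v.
Proof. by rewrite -{1}[u]revK wact_revK. Qed.

Lemma wact_inj u : injective (wact u).
Proof. exact: can_inj (wact_revK u). Qed.

Definition form (u v : V) : R := \sum_s coroot s u * v s.

Lemma formDl u1 u2 v : form (u1 + u2) v = form u1 v + form u2 v.
Proof. by rewrite /form -big_split; apply: eq_bigr => j _; rewrite corootD mulrDl. Qed.

Lemma formZl a u v : form (a *: u) v = a * form u v.
Proof. by rewrite /form mulr_sumr; apply: eq_bigr => j _; rewrite corootZ mulrA. Qed.

Lemma formDr u v1 v2 : form u (v1 + v2) = form u v1 + form u v2.
Proof. by rewrite /form -big_split; apply: eq_bigr => j _; rewrite ffunE mulrDr. Qed.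

Lemma formZr a u v : form u (a *: v) = a * form u v.
Proof.
rewrite /form mulr_sumr; apply: eq_bigr => j _.
by rewrite ffunE -[a *: _]/(a * _) mulrCA.
Qed.

Lemma form_simpler u s : form u (simple s) = coroot s u.
Proof.
rewrite /form (bigD1 s) //= ffunE eqxx mulr1 big1 ?addr0 // => j /negPf js.
by rewrite ffunE js mulr0.
Qed.

Lemma form_simplel v s : form (simple s) v = coroot s v.
Proof.
apply: eq_bigr => j _; rewrite coroot_simple mulrC eq_sym.
by case: eqP => // _; rewrite c_sym.
Qed.

Lemma form_refl s u v : form (refl s u) (refl s v) = form u v.
Proof.
rewrite /refl -!scaleNr formDl !formDr !formZl !formZr form_simpler.
by rewrite !form_simplel coroot_simple eqxx; ring.
Qed.

Lemma form_wact w u v : form (wact w u) (wact w v) = form u v.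
Proof. by elim: w => //= s w IHw; rewrite form_refl. Qed.

Lemma simple_inj : injective simple.
Proof.
move=> s t /ffunP/(_ s); rewrite !ffunE eqxx.
by case: eqP => // _ /esym/eqP; rewrite eq_sym oner_eq0.
Qed.

Lemma simple_root_scale w s t a : wact w (simple s) = a *: simple t -> a = 1 \/ a = -1.
Proof.
move=> h; have := form_wact w (simple s) (simple s).
rewrite h formZl formZr !form_simpler !coroot_simple !eqxx => h2.
suff /eqP : a ^+ 2 = 1 by rewrite sqrf_eq1 => /orP[/eqP|/eqP]; tauto.
by apply: (mulIf (_ : 2 != 0 :> R)); rewrite ?mul1r ?pnatr_eq0 // -[RHS]h2; ring.
Qed.

(** * Alternating words and the braid relations *)

Fixpoint alt (k : nat) (s t : S) : seq S :=
  if k is k'.+1 then s :: alt k' t s else [::].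

Lemma size_alt k s t : size (alt k s t) = k.
Proof. by elim: k s t => //= k IHk s t; rewrite IHk. Qed.

Lemma alt_rcons k s t :
  alt k.+1 s t = rcons (alt k s t) (if odd k then t else s).
Proof.
elim: k s t => // k IHk s t.
by rewrite -[LHS]/(s :: alt k.+1 t s) IHk /=; case: (odd k).
Qed.

Lemma rev_alt k s t :
  rev (alt k s t) = if odd k then alt k s t else alt k t s.
Proof.
elim: k s t => // k IHk s t.
rewrite alt_rcons rev_rcons IHk /=; case ok: (odd k) => //=.
by rewrite -[s :: _]/(alt k.+1 s t) alt_rcons ok.
Qed.

Lemma wact_alt k s t : s != t ->
  wact (alt k s t) (simple (if odd k then t else s)) =
  chebU (c s t) k.+1 *: simple s + chebU (c s t) k *: simple t.
Proof.
move=> st; elim: k s t st => [|k IHk] s t st.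
  by rewrite /= scale1r scale0r addr0.
rewrite [LHS]/=; have := IHk t s; rewrite eq_sym => /(_ st).
rewrite if_neg => ->.
rewrite reflD !reflZ refl_simple refl_simpleN // (c_sym t s) chebUSS.
by apply/ffunP => i; rewrite !ffunE /GRing.scale /=; ring.
Qed.

Lemma alt_cat i j s t :
  alt (i + j) s t = alt i s t ++ if odd i then alt j t s else alt j s t.
Proof. by elim: i s t => // i IHi s t /=; rewrite IHi; case: (odd i). Qed.

Lemma dihedral_coef_sqr s t : 4 - c s t ^+ 2 != 0.
Proof.
have [c2 _ _] := cP s t; have c0 := dihedral_coef_ge0 (M_ge2 s t) (cP s t).
by rewrite gt_eqF //; nra.
Qed.

(** Both sides send [simple r] to [- simple t]: [alt (M s t).-1 s t] carries [simple r] to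
    [simple t], and the two words extend it by [r] on the right and by [t] on the left. *)
Lemma wact_braid_simple s t : s != t ->
  let r := if odd (M s t).-1 then t else s in
  wact (alt (M s t) s t) (simple r) = wact (alt (M s t) t s) (simple r).
Proof.
move=> st r; have Mp : M s t = (M s t).-1.+1 by have := M_ge2 s t; lia.
have hr : wact (alt (M s t).-1 s t) (simple r) = simple t.
  rewrite wact_alt // -Mp; have [_ _ ->] := cP s t.
  by rewrite (chebU_pred (M_ge2 s t) (cP s t)) scale0r scale1r add0r.
rewrite {1}Mp alt_rcons wact_rcons refl_simple wactN hr.
by rewrite Mp /= hr refl_simple.
Qed.

Lemma wact_braid s t v : s != t ->
  wact (alt (M s t) s t) v = wact (alt (M s t) t s) v.
Proof.
move=> st; set x := coroot s v; set y := coroot t v.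
have d0 := dihedral_coef_sqr s t.
(* Cramer's rule with determinant [4 - c s t ^+ 2]: both coroots vanish at [v0], which is therefore
   fixed by both words. *)
pose p := (2 * x + c s t * y) / (4 - c s t ^+ 2).
pose q := (c s t * x + 2 * y) / (4 - c s t ^+ 2).
pose v0 := v - (p *: simple s + q *: simple t).
have ns : (t == s) = false by rewrite eq_sym; apply: negbTE.
have v0s : coroot s v0 = 0.
  rewrite /v0 -scaleN1r corootD corootZ corootD !corootZ !coroot_simple eqxx ns.
  by rewrite (c_sym t s) -/x /p /q; field.
have v0t : coroot t v0 = 0.
  rewrite /v0 -scaleN1r corootD corootZ corootD !corootZ !coroot_simple eqxx.
  by rewrite (negbTE st) -/y /p /q; field.
have vE : v = v0 + (p *: simple s + q *: simple t) by rewrite subrK.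
clearbody v0 p q; rewrite {v x y d0}vE.
have fix0 k a b : coroot a v0 = 0 -> coroot b v0 = 0 -> wact (alt k a b) v0 = v0.
  elim: k a b => //= k IHk a b a0 b0.
  by rewrite IHk // /refl a0 scale0r subr0.
rewrite !wactD !wactZ !fix0 //.
have h1 := wact_braid_simple st.
have h2 := @wact_braid_simple t s; rewrite eq_sym in h2.
move/(_ st): h2; rewrite (M_sym t s) => h2.
by case: (odd _) h1 h2 => /= -> ->.
Qed.

(** * Length, descents and signs of roots *)

Definition pos (v : V) := forall i, 0 <= v i.

Definition weq u v := wact u =1 wact v.

Definition short u := forall v, weq v u -> (size u <= size v)%N.

(** The inequality is weak, so that the parity of lengths never enters. *)
Definition nodesc u s := forall v, weq v (rcons u s) -> (size u <= size v)%N.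

Lemma shortE u v : weq u v -> size u = size v -> short u -> short v.
Proof. by move=> uv suv hu w wv; rewrite -suv; apply: hu => x; rewrite wv uv. Qed.

Lemma nodescE u v s : weq u v -> size u = size v -> nodesc u s -> nodesc v s.
Proof.
move=> uv suv hu w wv; rewrite -suv; apply: hu => x.
by rewrite wv !wact_rcons uv.
Qed.

Lemma exists_short u : exists2 v, short v & weq v u.
Proof.
have [n] := ubnP (size u); elim: n u => // n IHn u un.
have [?|/existsNP[v /not_implyP[vu /negP]]] := pselect (short u); first by exists u.
rewrite -ltnNge => vn; have [|w sw wv] := IHn v; first by lia.
by exists w => // x; rewrite wv vu.
Qed.

(* Moving letters from [v] into the alternating suffix as long as it can be
   lengthened makes [v] minimal in its coset modulo [<a, b>]. *)
Lemma pos_dihedral n :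
  (forall u s, (size u < n)%N -> short u -> nodesc u s -> pos (wact u (simple s))) ->
  forall v k a b, a != b -> (0 < k)%N -> (size v + k)%N = n ->
  let s := if odd k then b else a in
  short (v ++ alt k a b) -> nodesc (v ++ alt k a b) s ->
  pos (wact (v ++ alt k a b) (simple s)).
Proof.
move=> IH v; have [p] := ubnP (size v); elim: p v => // p IHp v vp k a b ab k0 vk.
move=> s su nu.
have sv : short v.
  move=> w wv; have := su (w ++ alt k a b); rewrite !size_cat leq_add2r; apply => x.
  by rewrite !wact_cat wv.
have sizeu : size (v ++ alt k a b) = n by rewrite size_cat size_alt.
have [nb|/existsNP[w /not_implyP[wv /negP]]] := pselect (nodesc v b); last first.
  rewrite -ltnNge => ltw.
  have vw : weq v (rcons w b) by move=> x; rewrite wact_rcons wv wact_rcons reflK.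
  have := sv _ (fun x => esym (vw x)); rewrite size_rcons => lev.
  have eqs : weq (v ++ alt k a b) (w ++ alt k.+1 b a).
    by move=> x; rewrite !wact_cat vw wact_rcons.
  have sizes : size (v ++ alt k a b) = size (w ++ alt k.+1 b a).
    by rewrite !size_cat !size_alt; lia.
  have sE : s = if odd k.+1 then a else b by rewrite /s /=; case: (odd k).
  rewrite eqs sE; apply: IHp; [lia|by rewrite eq_sym|by []|lia| |].
  - exact: shortE eqs sizes su.
  - by rewrite -sE; apply: nodescE eqs sizes nu.
(* A descent at [a] would cancel the first letter of the suffix and shorten the word. *)
have na : nodesc v a.
  move=> w wv; rewrite leqNgt; apply/negP => ltw.
  have := su (w ++ alt k.-1 b a); rewrite !size_cat !size_alt => h.
  suff : (size v + k <= size w + k.-1)%N by lia.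
  apply: h => x; rewrite !wact_cat wv wact_rcons.
  by case: k k0 {vk su nu sizeu s} => // k _.
(* Otherwise, after appending [s], a braid move on the [M a b] letters following the first [a] of
   the suffix creates [a a]; cancelling it contradicts [nodesc]. *)
have kM : (k < M a b)%N.
  rewrite ltnNge; apply/negP => Mk.
  have [j kE] : exists j, k = (M a b + j)%N by exists (k - M a b)%N; lia.
  pose tl := if odd (M a b) then alt j a b else alt j b a.
  have := nu (v ++ alt (M a b).-1 b a ++ tl).
  rewrite !size_cat !size_alt.
  have -> : size tl = j by rewrite /tl; case: ifP; rewrite size_alt.
  have M2 := M_ge2 a b.
  suff h : weq (v ++ alt (M a b).-1 b a ++ tl) (rcons (v ++ alt k a b) s).
    by move/(_ h); lia.
  have -> : rcons (v ++ alt k a b) s = v ++ a :: alt (M a b) b a ++ tl.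
    by rewrite rcons_cat -alt_rcons kE /= alt_cat.
  move=> x; rewrite !wact_cat wact_cons wact_cat -wact_braid //.
  by rewrite -[M a b in RHS](prednK (ltnW M2)) [alt _ _ _]/= wact_cons reflK.
rewrite /s wact_cat wact_alt // wactD !wactZ => i.
have [_ qpos qM] := cP a b.
have q0 l : (l <= M a b)%N -> 0 <= chebU (c a b) l.
  case: l => // l; rewrite leq_eqVlt => /orP[/eqP->|lM]; first by rewrite qM.
  by rewrite ltW // qpos.
have vn : (size v < n)%N by lia.
by rewrite !ffunE addr_ge0 // mulr_ge0 ?q0 //; [apply: IH|lia|apply: IH].
Qed.

Lemma pos_nodesc u s : short u -> nodesc u s -> pos (wact u (simple s)).
Proof.
have [n] := ubnP (size u); elim: n u s => // n IHn u s un.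
case: (lastP u) un => [|v t] un su nu; first by move=> i; rewrite ffunE ler0n.
have st : t != s.
  apply/eqP => ts; have := nu v; rewrite size_rcons ltnn => h.
  by suff: false by []; apply: h => x; rewrite ts !wact_rcons reflK.
rewrite -cats1 in un su nu *.
rewrite size_cat addn1 in un.
apply: (@pos_dihedral (size v).+1 _ v 1 t s) => //.
- by move=> w r wn; apply: IHn; lia.
- by rewrite addn1.
Qed.

(** At a descent, [- u (simple s) = (u s) (simple s)], and [u s] no longer descends at [s]. *)
Lemma root_sign u s : pos (wact u (simple s)) \/ pos (- wact u (simple s)).
Proof.
have [v sv vu] := exists_short u; rewrite -vu.
have [/(pos_nodesc sv)|] := pselect (nodesc v s); first by left.
move=> /existsNP[w /not_implyP[wv /negP]]; rewrite -ltnNge => ltw.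
right; have [x sx xw] := exists_short w.
rewrite -wactN -refl_simple -wact_rcons -wv -xw; apply: pos_nodesc => // y yx.
have := sx w (fun z => esym (xw z)).
suff /sv : weq y v by lia.
by move=> z; rewrite yx wact_rcons xw wv wact_rcons reflK.
Qed.

Lemma pos_neg0 v : pos v -> pos (- v) -> v = 0.
Proof.
move=> p n; apply/ffunP => i; apply: le_anti.
by have := n i; rewrite !ffunE oppr_ge0 => ->; apply: p.
Qed.

Lemma wact0 u : wact u 0 = 0.
Proof. by rewrite -(scale0r (0 : V)) wactZ !scale0r. Qed.

Lemma simple_neq0 s : simple s <> 0.
Proof. by move/ffunP/(_ s)/eqP; rewrite !ffunE eqxx oner_eq0. Qed.

Lemma wact_simple_neq0 u s : wact u (simple s) <> 0.
Proof. by rewrite -(wact0 u) => /wact_inj/simple_neq0. Qed.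

Lemma refl_off s v i : i != s -> refl s v i = v i.
Proof. by move=> /negPf si; rewrite !ffunE si /GRing.scale /= mulr0 subr0. Qed.

Lemma wact_off (Y : pred S) u v i : all Y u -> ~~ Y i -> wact u v i = v i.
Proof.
move=> uY Yi; elim: u uY => // s u IHu /= /andP[Ys uY].
by rewrite refl_off ?IHu //; apply: contraNneq Yi => ->.
Qed.

(** A reflection changes a single coordinate, so a positive root turned negative is a multiple of
    [simple s]; the invariant form and positivity leave only [simple s]. *)
Lemma pos_root_refl u x s : pos (wact u (simple x)) ->
  wact u (simple x) <> simple s -> pos (refl s (wact u (simple x))).
Proof.
move=> p ns; have [//|n] := root_sign (s :: u) x.
have uE : wact u (simple x) = wact u (simple x) s *: simple s.
  apply/ffunP => i; rewrite !ffunE /GRing.scale /=.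
  case: eqP => [->|/eqP si]; first by rewrite mulr1.
  rewrite mulr0; apply: le_anti; rewrite p andbT.
  by have := n i; rewrite ffunE wact_cons refl_off // oppr_ge0.
have [h|h] := simple_root_scale uE; first by rewrite h scale1r in uE.
by have := p s; rewrite h lerNr oppr0 ler10.
Qed.

Lemma refl_conj u x s v : wact u (simple x) = simple s ->
  refl s (wact u v) = wact u (refl x v).
Proof.
move=> h; rewrite /refl -[- (coroot x v *: _)]scaleNr wactD wactZ scaleNr h.
by rewrite -!form_simpler -[form _ (simple s)](_ : form v (simple x) = _) // -h form_wact.
Qed.

(** * Coset walks with labels *)

Section Walks.
Variable X : pred S.

(* Minimal representatives of the left cosets of the parabolic subgroup of
   [X]. *)
Definition minrep (w : V -> V) :=
  (exists u, w = wact u) /\ forall x, X x -> pos (w (simple x)).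

(* [Some x] when [s w = w x], that is when [s] fixes the coset of [w]. *)
Definition label (w : V -> V) (s : S) : option S :=
  [pick x | X x && (w (simple x) == simple s)].

Lemma labelP w s x : label w s = Some x -> X x /\ w (simple x) = simple s.
Proof. by rewrite /label; case: pickP => // y /andP[Xy /eqP wy] [<-]. Qed.

Lemma labelE w s x : minrep w -> X x -> w (simple x) = simple s ->
  label w s = Some x.
Proof.
move=> [[u ->] _] Xx wx; rewrite /label; case: pickP => [y /andP[_ /eqP]|/(_ x)].
  by rewrite -wx => /wact_inj/simple_inj ->.
by rewrite Xx wx eqxx.
Qed.

Lemma label_None w s x : label w s = None -> X x -> w (simple x) <> simple s.
Proof.
by rewrite /label; case: pickP => // /(_ x) + _ Xx wx; rewrite Xx wx eqxx.
Qed.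

Lemma minrep_id : minrep id.
Proof. by split; [exists [::]|move=> x _ i; rewrite ffunE ler0n]. Qed.

Lemma minrep_refl w s : minrep w -> label w s = None -> minrep (refl s \o w).
Proof.
move=> [[u ->] p] ls; split; first by exists (s :: u).
by move=> x Xx; apply: pos_root_refl; [apply: p|apply: label_None ls Xx].
Qed.

Lemma label_refl w s : minrep w -> label (refl s \o w) s = None.
Proof.
move=> [_ p]; case l: label => [x|//]; have [Xx /= wx] := labelP l.
have := p x Xx s; rewrite -[w _](reflK s) wx refl_simple !ffunE eqxx.
by rewrite oppr_ge0 ler10.
Qed.

(** Letters are read from the right. The labels [o] are collected in the order that gives
    [u w = w' o], with [w'] the final representative. *)
Fixpoint walk (u : seq S) (w : V -> V) : (V -> V) * seq S :=
  if u is s :: u' then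
    let p := walk u' w in
    if label p.1 s is Some x then (p.1, x :: p.2) else (refl s \o p.1, p.2)
  else (w, [::]).

Lemma minrep_walk u w : minrep w -> minrep (walk u w).1.
Proof.
move=> mw; elim: u => //= s u IHu.
by case l: label => [x|] //=; apply: minrep_refl.
Qed.

Lemma walk_label u w : all X (walk u w).2.
Proof.
elim: u => //= s u IHu; case l: label => [x|] //=.
by rewrite IHu andbT; case: (labelP l).
Qed.

Lemma walk_cat u1 u2 w :
  walk (u1 ++ u2) w =
  ((walk u1 (walk u2 w).1).1, (walk u1 (walk u2 w).1).2 ++ (walk u2 w).2).
Proof.
elim: u1 => [|s u1 /= ->] /=; first by case: walk.
by case: label.
Qed.

Lemma walk_wact u w v : minrep w ->
  wact u (w v) = (walk u w).1 (wact (walk u w).2 v).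
Proof.
move=> mw; elim: u v => //= s u IHu v; rewrite IHu.
case l: label => [x|] //=; have [Xx wx] := labelP l.
have [[u' uE] _] := minrep_walk u mw.
by rewrite uE in wx *; rewrite (refl_conj _ wx).
Qed.

(** With at most one letter on each side, signs decide: a reflection in [o1] negates its simple
    root, while the other side keeps that root positive unless it is the same reflection. *)
Lemma minrep_unique w1 w2 o1 o2 : minrep w1 -> minrep w2 ->
  all X o1 -> all X o2 -> (size o1 <= 1)%N -> (size o2 <= 1)%N ->
  (forall v, w1 (wact o1 v) = w2 (wact o2 v)) -> w1 = w2 /\ o1 = o2.
Proof.
have notneg w w' x v : minrep w -> X x -> pos (w' v) -> w (- simple x) <> w' v.
  move=> [[u ->] p1] Xx p2 h; apply: (@wact_simple_neq0 u x).
  by apply: pos_neg0; [apply: p1|rewrite -wactN h].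
have one w w' x : minrep w -> minrep w' -> X x ->
    ~ forall v, w (refl x v) = w' v.
  move=> m1 [_ p2] Xx /(_ (simple x)); rewrite refl_simple.
  by apply: notneg => //; apply: p2.
case: o1 o2 => [|x [|//]] [|y [|//]] m1 m2 //= X1 X2 _ _ h.
- by split=> //; apply/funext.
- by case: (one w2 w1 y); rewrite // ?andbT in X2 *.
- by case: (one w1 w2 x); rewrite // ?andbT in X1 *.
rewrite !andbT in X1 X2.
have xy : x = y.
  have := h (simple x); rewrite refl_simple.
  case: (eqVneq y x) => // yx; rewrite refl_simpleN // => h'; exfalso.
  move: h'; apply: notneg => //; case: m2 => [[u ->] p2] i.
  rewrite wactD wactZ !ffunE addr_ge0 ?p2 // mulr_ge0 ?p2 //.
  exact: dihedral_coef_ge0 (M_ge2 _ _) (cP x y).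
split; last by rewrite xy.
by apply/funext => v; have := h (refl x v); rewrite -xy reflK.
Qed.

Lemma rev_alt_rcons k s t :
  rev (alt k.+1 s t) = (if odd k then t else s) :: rev (alt k s t).
Proof. by rewrite alt_rcons rev_rcons. Qed.

(* The cosets met by an alternating walk form a path with [M s t] vertices whose
   two ends carry a loop with the same label: a walk of [M s t] steps uses one
   loop, whichever letter it starts with. *)
Lemma walk_alt_after_label w s t x j :
  minrep w -> s != t -> X x -> w (simple x) = simple s -> label w t = None ->
  (j < M s t)%N ->
  walk (rev (alt j t s)) w = (wact (rev (alt j t s)) \o w, [::]).
Proof.
move=> mw st Xx wx lt; elim: j => // j IHj jM.
rewrite rev_alt_rcons /= IHj ?(ltnW jM) //=.
case l: label => [y|//]; exfalso; have [Xy /= wy] := labelP l.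
case: j => [|j] in IHj jM l wy; first by rewrite /= l in lt.
case: mw => [[u uE] _]; rewrite uE in wx wy.
(* Undoing the walk and then [u] gives [simple y = a *: u^-1 (simple t) + b *: simple x] with [a]
   and [b] positive. If [y] is [x], then [a] vanishes; if not, the root [u^-1 (simple t)] has
   coordinates of both signs. *)
have := congr1 (wact (alt j.+1 t s)) wy; rewrite wactK_rev wact_alt; last by rewrite eq_sym.
set a := chebU _ _; set b := chebU _ _ => h.
have [_ qpos _] := cP t s.
have a0 : 0 < a by apply: qpos; rewrite M_sym.
have b0 : 0 < b by apply: qpos; rewrite M_sym (ltnW jM).
have := congr1 (wact (rev u)) h; rewrite wactD !wactZ -wx !wact_revK => /ffunP g.
case: (eqVneq x y) => [xy|xy].
  rewrite -xy wx in h; have /ffunP/(_ t) := h.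
  rewrite !ffunE eqxx eq_sym (negbTE st) /GRing.scale /= mulr1 mulr0 addr0 => a0'.
  by rewrite -a0' ltxx in a0.
have := g x; have := g y; rewrite !ffunE !eqxx (negbTE xy) eq_sym (negbTE xy) /GRing.scale /=.
have [p|p] := root_sign (rev u) t; have := p x; have := p y; rewrite ?ffunE; nra.
Qed.

(** After a loop the rest of the walk has no label, by [walk_alt_after_label]; after a move the
    letter just used does not loop, so the hypothesis passes to the new coset. *)
Lemma size_walk_alt w k a b : minrep w -> a != b -> (k <= M a b)%N ->
  label w a = None \/ label w b = None ->
  (size (walk (rev (alt k a b)) w).2 <= 1)%N.
Proof.
elim: k w a b => // k IHk w a b mw ab kM nf.
rewrite [alt _ _ _]/= rev_cons -cats1 walk_cat /=.
case l: label => [x|] /=.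
  have [Xx wx] := labelP l.
  rewrite (walk_alt_after_label mw ab Xx wx) //=.
  by case: nf => //; rewrite l.
rewrite cats0; apply: IHk; rewrite 1?eq_sym // 1?M_sym ?(ltnW kM) //.
  exact: minrep_refl.
by right; apply: label_refl.
Qed.

Lemma walk_alt_fixed w k a b x y : label w a = Some x -> label w b = Some y ->
  walk (alt k a b) w = (w, alt k x y).
Proof.
elim: k a b x y => // k IHk a b x y la lb.
by rewrite /= (IHk _ _ _ _ lb la) /= la.
Qed.

(** Unless both letters loop, each walk has at most one label, and [minrep_unique] identifies the
    walks because both words act alike. If both loop, the labels spell the two sides of a braid
    relation. *)
Lemma walk_braid w s t : minrep w -> s != t ->
  walk (alt (M s t) s t) w = walk (alt (M s t) t s) w \/
  exists x y, [/\ x != y, M x y = M s t,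
    walk (alt (M s t) s t) w = (w, alt (M s t) x y) &
    walk (alt (M s t) t s) w = (w, alt (M s t) y x)].
Proof.
move=> mw st.
have one : label w s = None \/ label w t = None ->
    walk (alt (M s t) s t) w = walk (alt (M s t) t s) w.
  move=> nf.
  have size1 a b : a != b -> M a b = M s t -> label w a = None \/ label w b = None ->
      (size (walk (alt (M s t) a b) w).2 <= 1)%N.
    move=> ab Mab nab; rewrite -(revK (alt _ _ _)) rev_alt.
    case: ifP => _; apply: size_walk_alt => //.
    - by rewrite Mab.
    - by rewrite eq_sym.
    - by rewrite (M_sym b a) Mab.
    - by case: nab; tauto.
  have s1 := size1 s t st erefl nf.
  have s2 : (size (walk (alt (M s t) t s) w).2 <= 1)%N.
    by apply: size1; [rewrite eq_sym|apply: M_sym|case: nf; tauto].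
  have [] := minrep_unique (minrep_walk (alt (M s t) s t) mw)
    (minrep_walk (alt (M s t) t s) mw) (walk_label _ _) (walk_label _ _) s1 s2.
    by move=> v; rewrite -!walk_wact // wact_braid.
  by do 2 case: walk => ? ? /=; move=> -> ->.
case ls: (label w s) => [x|]; last by left; apply: one; left.
case lt: (label w t) => [y|]; last by left; apply: one; right.
right; exists x, y; have [_ wx] := labelP ls; have [_ wy] := labelP lt.
have xy : x != y.
  by apply: contra_neq st => xy; apply: simple_inj; rewrite -wx -wy xy.
split=> //; try exact: walk_alt_fixed.
case: mw wx wy => [[u ->] _] wx wy.
(* Invariance of the form gives [c x y = c s t], and the coefficient determines the label. *)
have := form_wact u (simple x) (simple y).
rewrite wx wy !form_simpler !coroot_simple (negbTE st) (negbTE xy) => /oppr_inj cE.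
by apply: (dihedral_coef_inj (M_ge2 s t) (cP s t)) => //; rewrite cE.
Qed.
End Walks.

(** * The retraction onto a parabolic subgroup *)

Section Retraction.
Variables (e : rel S) (m : S -> S -> nat).
Hypotheses (e_irr : irreflexive e) (M_edge : forall s t, e s t -> M s t = m s t).
Hypothesis edge_of_M : forall s t x y,
  e s t -> x != y -> M x y = M s t -> e x y.
Variable X : pred S.
Local Notation G := (artin_group e m).
Local Notation cls := (@cls S e m).

(** A letter and its inverse move the coset alike, moves being involutions; only a loop label keeps
    the exponent [l.2]. *)
Definition ract (l : S * bool) (p : (V -> V) * G) : (V -> V) * G :=
  if label X p.1 l.1 is Some x then (p.1, (cls [:: (x, l.2)] * p.2)%g)
  else (refl l.1 \o p.1, p.2).

Let P (p : (V -> V) * G) := minrep X p.1.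

Definition positive (u : seq S) : word S := [seq (s, true) | s <- u].

Lemma positive_alt k s t : positive (alt k s t) = alt_word k s t.
Proof. by elim: k s t => //= k IHk s t; rewrite -IHk. Qed.

Lemma ractP l p : P p -> P (ract l p).
Proof. by rewrite /P /ract => Pp; case l1: label => [x|] //=; apply: minrep_refl. Qed.

Lemma ractK s b p : P p -> ract (s, b) (ract (s, ~~ b) p) = p.
Proof.
case: p => w g Pp; rewrite {2}/ract /=; case l1: label => [x|].
  rewrite /ract /= l1 mulgA -cls_cat (_ : cls _ = 1%g) ?mul1g //.
  exact: cls_cancel.
by rewrite /ract /= label_refl //; congr pair; apply/funext => v; rewrite /= reflK.
Qed.

Lemma wordact_positive u w g :
  wordact ract (positive u) (w, g) =
  ((walk X u w).1, (cls (positive (walk X u w).2) * g)%g).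
Proof.
elim: u => [|s u IHu]; first by rewrite /= cls_nil mul1g.
rewrite -[positive _]/((s, true) :: positive u) wordact_cons IHu.
rewrite /ract /=; case: label => [x|] //=.
by rewrite mulgA -cls_cat.
Qed.

Lemma ractR u v p : artin_rel e m u v -> P p -> wordact ract u p = wordact ract v p.
Proof.
case=> s t st; case: p => w g mw.
have nst : s != t by apply: contraTneq st => ->; rewrite e_irr.
rewrite -!positive_alt !wordact_positive -(M_edge st).
have [->//|[x [y [xy Mxy -> ->]]]] := walk_braid mw nst.
rewrite /= !positive_alt; congr (_, _ * _)%g.
have exy := edge_of_M st xy Mxy.
by rewrite -Mxy (M_edge exy) cls_rel.
Qed.

Lemma ract_cls u v p : cls u = cls v -> P p -> wordact ract u p = wordact ract v p.
Proof.
by move=> /pclassP uv; apply: wordact_pres_eq uv; [apply: ractP|apply: ractK|apply: ractR].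
Qed.

Lemma simple_label_id x : X x -> label X id x = Some x.
Proof. by move=> Xx; apply: labelE => //; apply: minrep_id. Qed.

Lemma ract_sub u : all (fun l => X l.1) u -> wordact ract u (id, 1%g) = (id, cls u).
Proof.
elim: u => // l u IHu; rewrite wordact_cons => /= /andP[Xl Xu].
rewrite IHu // /ract /= simple_label_id //.
by rewrite -cls_cat; case: l {Xl}.
Qed.

(** Reflections in [Y] fix the coordinates outside [Y]. For a label [x] outside [Y], the equation
    [w (simple x) = simple l.1] would have coordinate 1 at [x] on the left and 0 on the right. *)
Lemma ract_support (Y : pred S) u : all (fun l => Y l.1) u ->
  (exists2 v, all Y v & (wordact ract u (id, 1%g)).1 = wact v) /\
  gen (fun s => X s && Y s) (wordact ract u (id, 1%g)).2.
Proof.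
elim: u => [_|l u IHu]; first by split; [exists [::]|apply: gen_one].
rewrite wordact_cons => /= /andP[Yl Yu].
have [[v Yv wv] g] := IHu Yu.
rewrite /ract.
case lx: label => [x|] /=; last first.
  by split=> //; exists (l.1 :: v); rewrite /= ?Yl // wv.
split; first by exists v.
apply: gen_mul => //; apply: gen_letter => /=.
have [Xx wx] := labelP lx; rewrite Xx /=; apply/negPn/negP => Yx.
have := wact_off (simple x) Yv Yx; rewrite -wv wx !ffunE eqxx.
by case: eqP => [xl|_ /eqP]; [rewrite xl Yl in Yx|rewrite eq_sym oner_eq0].
Qed.

(** Both words for [g] are applied to the base point: the word in [X] returns [(id, g)], and the
    word in [Y] a second component in the subgroup of the intersection. *)
Lemma gen_inter (Y : pred S) (g : G) : gen X g -> gen Y g -> gen (fun s => X s && Y s) g.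
Proof.
move=> [u Xu gu] [v Yv gv].
have [_] := ract_support Yv.
by rewrite -(@ract_cls u v) ?ract_sub //= -?gu // ?gv //; apply: minrep_id.
Qed.

(** Words in [X] fix the base coset, while [t] moves it. *)
Lemma gen_notin t : ~~ X t -> ~ gen X (cls [:: (t, true)]).
Proof.
move=> Xt [u Xu /esym h].
have := ract_cls h (minrep_id X : P (id, 1%g)); rewrite ract_sub //.
rewrite /= /ract /=; case l: label => [x|] /=.
  by have [Xx /simple_inj xt] := labelP l; rewrite -xt Xx in Xt.
by case=> /(congr1 (@^~ (simple t))) /= + _; move/esym; rewrite refl_simple => h1;
  apply: (@simple_neq0 t); apply: pos_neg0; rewrite ?h1 => i; rewrite ffunE ler0n.
Qed.

End Retraction.
End Reflections.

(** * The coefficients [2 cos (pi / m)] *)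

Lemma dihedral_coef_cos (R : realType) (m : nat) : (2 <= m)%N ->
  dihedral_coef m (2 * cos (pi / m%:R : R)).
Proof.
move=> m2; set x : R := pi / m%:R.
have m0 : 0 < m%:R :> R by rewrite ltr0n ltnW.
have xm : x * m%:R = pi by rewrite /x divfK // gt_eqF.
have x0 : 0 < x by rewrite divr_gt0 // pi_gt0.
have s0 k : (0 < k < m)%N -> 0 < sin (x * k%:R).
  move=> /andP[k0 km]; apply: sin_gt0_pi.
  by rewrite mulr_gt0 ?ltr0n //= -xm ltr_pM2l // ltr_nat.
have sx : 0 < sin x by have := s0 1%N; rewrite mulr1; apply; rewrite m2.
have U k : chebU (2 * cos x) k * sin x = sin (x * k%:R) /\
    chebU (2 * cos x) k.+1 * sin x = sin (x * k.+1%:R).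
  elim: k => [|k [IH1 IH2]]; first by rewrite mulr0 sin0 mul0r mul1r mulr1.
  split=> //; rewrite chebUSS mulrBl IH1 -mulrA IH2.
  have -> : x * k%:R = x * k.+1%:R - x by rewrite -[k.+1]addn1 natrD; ring.
  have -> : x * k.+2%:R = x * k.+1%:R + x by rewrite -[k.+2]addn1 natrD; ring.
  by rewrite sinB sinD; ring.
split.
- have := cos2Dsin2 x; nra.
- by move=> k km; have := s0 k km; have [<- _] := U k; rewrite pmulr_lgt0.
- by have [+ _] := U m; rewrite xm sinpi => /eqP; rewrite mulf_eq0 (gt_eqF sx) orbF => /eqP.
Qed.

(** * Intersections of standard parabolic subgroups *)

Section Parabolic.
Variables (S : finType) (e : rel S) (m : S -> S -> nat).
Hypotheses (e_sym : symmetric e) (e_irr : irreflexive e)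
  (m_sym : forall s t : S, e s t -> m s t = m t s)
  (m_ge2 : forall s t : S, e s t -> (2 <= m s t)%N).

(* Non-edges get a finite label exceeding all edge labels: a pair of vertices
   with the label of an edge is then an edge. *)
Definition coxeter_label (s t : S) : nat :=
  if e s t then m s t else (\max_(p : S * S) m p.1 p.2).+2.

Lemma coxeter_label_sym s t : coxeter_label s t = coxeter_label t s.
Proof. by rewrite /coxeter_label e_sym; case: ifP => // /m_sym ->. Qed.

Lemma coxeter_label_ge2 s t : (2 <= coxeter_label s t)%N.
Proof. by rewrite /coxeter_label; case: ifP => // /m_ge2. Qed.

Lemma coxeter_label_edge s t : e s t -> coxeter_label s t = m s t.
Proof. by rewrite /coxeter_label => ->. Qed.

Lemma edge_of_coxeter_label s t x y : e s t -> x != y ->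
  coxeter_label x y = coxeter_label s t -> e x y.
Proof.
move=> st _; rewrite (coxeter_label_edge st) /coxeter_label; case: ifP => // _ h.
have := leq_bigmax (F := fun p : S * S => m p.1 p.2) (s, t).
by rewrite /= -h ltnNge leqnSn.
Qed.

Let c (s t : S) : Rdefinitions.R := 2 * cos (pi / (coxeter_label s t)%:R).

Let c_sym s t : c s t = c t s.
Proof. by rewrite /c coxeter_label_sym. Qed.

Let cP s t : dihedral_coef (coxeter_label s t) (c s t).
Proof. exact/dihedral_coef_cos/coxeter_label_ge2. Qed.

Lemma parabolic_inter (X Y : pred S) (g : artin_group e m) :
  gen X g -> gen Y g -> gen (fun s => X s && Y s) g.
Proof.
exact: (gen_inter coxeter_label_sym coxeter_label_ge2 c_sym cP e_irr
  coxeter_label_edge edge_of_coxeter_label).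
Qed.

Lemma parabolic_notin (X : pred S) t :
  ~~ X t -> ~ gen X (cls e m [:: (t, true)]).
Proof.
exact: (gen_notin coxeter_label_sym coxeter_label_ge2 c_sym cP e_irr
  coxeter_label_edge edge_of_coxeter_label).
Qed.

Lemma parabolic_bigcap (g : artin_group e m) :
  (forall s, gen (fun r => r != s) g) -> g = 1%g.
Proof.
move=> h.
have ind (l : seq S) : gen (fun r => r \notin l) g.
  elim: l => [|s l IHl].
    by exists (repr (g : presented _)); rewrite ?cls_repr //; apply/allP.
  apply: gen_sub (parabolic_inter IHl (h s)) => r /andP[rl rs].
  by rewrite in_cons negb_or rs.
(* Once all vertices are excluded, only the empty word remains. *)
have [[|l u] /= hu ->] := ind (enum S); first exact: cls_nil.
by rewrite mem_enum in hu.
Qed.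
End Parabolic.

Theorem theorem3p3 (S : finType) (e : rel S) (m : S -> S -> nat)
    (e_sym : symmetric e) (e_irr : irreflexive e)
    (m_sym : forall s t : S, e s t -> m s t = m t s)
    (m_ge2 : forall s t : S, e s t -> (2 <= m s t)%N)
    (not_star : ~ is_star e) :
  group_center (artin_group e m) = [set 1%g]%classic.
Proof.
apply/seteqP; split=> [z cz|z ->]; last by move=> g; rewrite /commute mul1g mulg1.
apply: (parabolic_bigcap e_sym e_irr m_sym m_ge2) => s.
have [t /not_implyP[ts /negP est]] : exists t, ~ (t != s -> e s t).
  by apply/existsNP => h; apply: not_star; exists s.
apply: (center_amalgam e_sym _ est _ cz); first by rewrite eq_sym.
by apply: parabolic_notin => //=; rewrite eqxx andbF.
Qed.
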